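(* Let $p$ be an odd prime and let $\lambda\in\mathbb{F}_p^\times$ be $\lambda=-1$ if $p\equiv 3\pmod 4$, and a generator of $\mathbb{F}_p^\times$ if $p\equiv 1\pmod 4$. Let $O_2^-(\mathbb{F}_p)=\{g\in GL_2(\mathbb{F}_p): g^T D g=D\}$ with $D=\operatorname{diag}(1,-\lambda)$, acting on $\mathbb{F}_p[x_1,x_2,y_1,y_2]$ by $(x_1,x_2)^T\mapsto g(x_1,x_2)^T$, $(y_1,y_2)^T\mapsto (g^T)^{-1}(y_1,y_2)^T$. For $f\in\mathbb{F}_p[x_1,x_2,y_1,y_2]$ let $\operatorname{Tr}(f)=\sum_{g\in O_2^-(\mathbb{F}_p)} g\cdot f$. Then the invariant ring $\mathbb{F}_p[x_1,x_2,y_1,y_2]^{O_2^-(\mathbb{F}_p)}$ is generated as an $\mathbb{F}_p$-algebra by $$x_1^2-\lambda x_2^2,\quad x_1^{p+1}-\lambda x_2^{p+1},\quad y_1^2-\lambda^{-1}y_2^2,\quad y_1^{p+1}-\lambda^{-1}y_2^{p+1},\quad x_1y_1+x_2y_2,\quad \operatorname{Tr}(x_1^{p+1-i}y_1^i)\ (1\le i\le p).$$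
   Context: $\lambda$ is a non-square in $\mathbb{F}_p^\times$, so $O_2^-(\mathbb{F}_p)$ is the orthogonal group of the anisotropic form $x_1^2-\lambda x_2^2$; it has order $2(p+1)$. The ring $\mathbb{F}_p[x_1,x_2,y_1,y_2]$ is $\mathbb{F}_p[V\oplus V^*]$ (one vector and one covector), with group elements acting as $\mathbb{F}_p$-algebra automorphisms. *)

(* Defs.v *)
From HB Require Import structures.
From mathcomp Require Import all_boot all_order all_algebra all_fingroup.
From mathcomp Require Import mpoly.
Set Implicit Arguments. Unset Strict Implicit. Unset Printing Implicit Defensive.
Import GRing.Theory.
Local Open Scope ring_scope.

Section Defs.
Variable p : nat.
Notation F := 'F_p.
Notation P4 := {mpoly F[4]}.

Definition x1 : P4 := 'X_(@inord 3 0).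
Definition x2 : P4 := 'X_(@inord 3 1).
Definition y1 : P4 := 'X_(@inord 3 2).
Definition y2 : P4 := 'X_(@inord 3 3).

Definition Dmx (lambda : F) : 'M[F]_2 :=
  \matrix_(i < 2, j < 2) (if i == j then (if i == 0 :> nat then 1 else - lambda) else 0).

Definition O2minus (lambda : F) : pred 'M[F]_2 :=
  fun g => (g \in unitmx) && (g^T *m Dmx lambda *m g == Dmx lambda).

Definition act_image (g : 'M[F]_2) (i : 'I_4) : P4 :=
  match val i with
  | 0 => (g 0 0)%:MP * x1 + (g 0 1)%:MP * x2
  | 1 => (g 1 0)%:MP * x1 + (g 1 1)%:MP * x2
  | 2 => ((invmx g)^T 0 0)%:MP * y1 + ((invmx g)^T 0 1)%:MP * y2
  | _ => ((invmx g)^T 1 0)%:MP * y1 + ((invmx g)^T 1 1)%:MP * y2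
  end.

Definition act (g : 'M[F]_2) (f : P4) : P4 :=
  comp_mpoly [tuple act_image g i | i < 4] f.

Definition Tr (lambda : F) (f : P4) : P4 :=
  \sum_(g : 'M[F]_2 | O2minus lambda g) act g f.

(* The p + 5 proposed generators:
   index 0..4 : x1^2 - l x2^2, x1^(p+1) - l x2^(p+1), y1^2 - l^-1 y2^2,
                y1^(p+1) - l^-1 y2^(p+1), x1 y1 + x2 y2;
   index 4+i (1 <= i <= p) : Tr(x1^(p+1-i) y1^i). *)
Definition gen (lambda : F) (k : 'I_(5 + p)) : P4 :=
  match val k with
  | 0 => x1 ^+ 2 - lambda%:MP * x2 ^+ 2
  | 1 => x1 ^+ p.+1 - lambda%:MP * x2 ^+ p.+1
  | 2 => y1 ^+ 2 - (lambda^-1)%:MP * y2 ^+ 2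
  | 3 => y1 ^+ p.+1 - (lambda^-1)%:MP * y2 ^+ p.+1
  | 4 => x1 * y1 + x2 * y2
  | j => Tr lambda (x1 ^+ (p + 1 - (j - 4)) * y1 ^+ (j - 4))
  end.

Definition gens (lambda : F) : (5 + p).-tuple P4 := [tuple gen lambda k | k < 5 + p].

Definition O2_invariant (lambda : F) (f : P4) : Prop :=
  forall g : 'M[F]_2, O2minus lambda g -> act g f = f.

Definition in_subalg n (gs : n.-tuple P4) (f : P4) : Prop :=
  exists P : {mpoly F[n]}, f = comp_mpoly gs P.

End Defs.

(* Main.v *)
Require Import Defs.
From HB Require Import structures.
From mathcomp Require Import all_boot all_order all_algebra all_fingroup all_field.
From mathcomp Require Import ring zify.
From mathcomp Require Import mpoly.
Import Defs.
Set Implicit Arguments. Unset Strict Implicit. Unset Printing Implicit Defensive.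
Import GRing.Theory.
Local Open Scope ring_scope.

(** Adjoin w with w^2 = lambda, so that w^p = -w, and put u, v = x1 +- w x2 and
a, b = y1 +- y2 / w.  A rotation of O_2^- multiplies u and b by z, and v and a by
z^-1, where z runs over the p+1 elements with z^(p+1) = 1; the remaining coset is
reached by exchanging u with v and a with b.  Hence an invariant is a combination
of sums m + m', where m = u^i v^j a^k b^l has weight (i + l) - (j + k) divisible by
n = p+1 and m' is m after the exchange.  By induction on the degree, the identity
(s + s')(t + t') = (st + s't') + (st' + s't) expresses all of these through uv, ab,
ua + vb and u^(n-i) b^i + v^(n-i) a^i for 0 <= i <= n.  The first three and the two
extreme ones (i = 0, n) are scalar multiples of the first five generators.
Expanding Tr(x1^(n-i) y1^i), the coefficient of u^(n-i) b^i is |O_2^-| / 2^n, a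
nonzero scalar, and all other surviving terms have weight 0, hence are polynomials
in uv, ab and ua + vb.  Finally, an F_p-linear retraction of F_p(w) onto F_p brings
the coefficients of the resulting expression back to F_p. *)

(** * Monomials under a dihedral action *)

Lemma eq_mod_cancel c x y x' y' n : x = y %[mod n] ->
  (x = x' + c)%N -> (y = y' + c)%N -> x' = y' %[mod n].
Proof. by move=> h ex ey; apply/eqP; rewrite -(eqn_modDr c) -ex -ey; apply/eqP. Qed.

Section DihedralMonomials.
Variables (R : comNzRingType) (S : R -> Prop) (u v a b : R) (n : nat).

Definition swap_sum (i j k l : nat) : R :=
  u ^+ i * v ^+ j * a ^+ k * b ^+ l + v ^+ i * u ^+ j * b ^+ k * a ^+ l.

Lemma swap_sumC i j k l : swap_sum i j k l = swap_sum j i l k.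
Proof. by rewrite /swap_sum; ring. Qed.

Lemma swap_sum_l i : swap_sum i 0 0 0 = u ^+ i + v ^+ i.
Proof. by rewrite /swap_sum; ring. Qed.

Lemma swap_sum_r i : swap_sum 0 0 0 i = a ^+ i + b ^+ i.
Proof. by rewrite /swap_sum; ring. Qed.

Hypothesis S1 : S 1.
Hypothesis SB : forall x y, S x -> S y -> S (x - y).
Hypothesis SM : forall x y, S x -> S y -> S (x * y).
Hypothesis Suv : S (u * v).
Hypothesis Sab : S (a * b).
Hypothesis Suavb : S (u * a + v * b).
Hypothesis Sn : forall i, (i <= n)%N -> S (swap_sum (n - i) 0 0 i).

Let below d := forall i j k l, (i + j + k + l < d)%N ->
  i + l = j + k %[mod n] -> S (swap_sum i j k l).

(** Multiply the orbit sum with one u and one a fewer by ua + vb: the cross term is divisible by uv,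
    or by ab when only one u is left, so everything else has smaller degree. *)
Local Lemma swap_sum_ua d i k : below d -> (i.+1 + k.+1 = d)%N -> i.+1 = k.+1 %[mod n] ->
  S (swap_sum i.+1 0 k.+1 0).
Proof.
move=> IH hd hm; have hm' := @eq_mod_cancel 1 _ _ i k _ hm.
case: i hd hm hm' => [|i] hd hm hm'; last first.
  have -> : swap_sum i.+2 0 k.+1 0 =
      (u * a + v * b) * swap_sum i.+1 0 k 0 - u * v * swap_sum i 0 k 1.
    by rewrite /swap_sum !exprS; ring.
  by apply: SB; apply: SM => //; apply: IH; try lia; rewrite ?addn0 ?addn1; apply: hm'; lia.
case: k hd hm hm' => [|k] hd hm hm'; first by rewrite /swap_sum !expr0 !expr1 !mulr1.
have -> : swap_sum 1 0 k.+2 0 =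
    (u * a + v * b) * swap_sum 0 0 k.+1 0 - a * b * swap_sum 0 1 k 0.
  by rewrite /swap_sum !exprS; ring.
by apply: SB; apply: SM => //; apply: IH; try lia; rewrite ?addn0 ?add1n; apply: hm'; lia.
Qed.

(** The letters u, b have weight 1 and v, a weight -1. One letter of each kind splits off as uv or
    ab, unless only u and a, or only v and b, occur; the exchange identifies these two cases. *)
Local Lemma swap_sum_mixed d i j k l : below d -> (i + j + k + l = d)%N ->
  i + l = j + k %[mod n] -> (0 < i + l)%N -> (0 < j + k)%N ->
  S (swap_sum i j k l).
Proof.
move=> IH hd hm hil hjk.
have hm' := @eq_mod_cancel 1 _ _ _ _ _ hm.
case: (posnP i) => [i0|i_gt0].
  case: (posnP k) => [k0|k_gt0].
    subst i k; case: j l hd hm hil hjk {hm'} => [//|j] [//|l] hd hm _ _.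
    rewrite swap_sumC; apply: (swap_sum_ua IH); first lia.
    by move: hm; rewrite add0n addn0.
  case: k l hd hm hil hjk k_gt0 hm' => [//|k] [|l] hd hm hil _ _ hm'; first lia.
  have -> : swap_sum i j k.+1 l.+1 = a * b * swap_sum i j k l.
    by rewrite /swap_sum !exprS; ring.
  by apply: SM => //; apply: IH; [lia | apply: hm'; lia].
case: (posnP j) => [j0|j_gt0].
  case: (posnP l) => [l0|l_gt0].
    subst j l; case: i k hd hm hil hjk i_gt0 {hm'} => [//|i] [//|k] hd hm _ _ _.
    apply: (swap_sum_ua IH); first lia.
    by move: hm; rewrite add0n addn0.
  case: k l hd hm hil hjk l_gt0 hm' => [|k] [//|l] hd hm hil hjk _ hm'; first lia.
  have -> : swap_sum i j k.+1 l.+1 = a * b * swap_sum i j k l.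
    by rewrite /swap_sum !exprS; ring.
  by apply: SM => //; apply: IH; [lia | apply: hm'; lia].
case: i j hd hm hil hjk i_gt0 j_gt0 hm' => [//|i] [//|j] hd hm _ _ _ _ hm'.
have -> : swap_sum i.+1 j.+1 k l = u * v * swap_sum i j k l.
  by rewrite /swap_sum !exprS; ring.
by apply: SM => //; apply: IH; [lia | apply: hm'; lia].
Qed.

(** Write u^i b^l = st with s of degree n. In (s + s')(t + t') the unwanted part st' + s't is a
    mixed orbit sum, and [Sn] covers s + s'. *)
Local Lemma swap_sum_pure d i l : below d -> (i + l = d)%N -> i + l = 0 %[mod n] ->
  S (swap_sum i 0 0 l).
Proof.
move=> IH hd; rewrite mod0n => /eqP; rewrite -/(n %| (i + l)%N)%N => hm.
(* In degree 0 the orbit sum is 1 + 1, while [S] is only assumed closed under differences and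
   products. *)
have S0 : S 0 by rewrite -(subrr 1); apply: SB.
have S2 : S (1 + 1) by rewrite -[X in 1 + X]opprK -[- 1]sub0r; apply: SB => //; apply: SB.
case: (posnP (i + l)) => [il0|il_gt0].
  have [-> ->] : i = 0%N /\ l = 0%N by lia.
  by rewrite /swap_sum !expr0 !mulr1.
have n_gt0 : (0 < n)%N by case: (posnP n) hm => // ->; rewrite dvd0n; lia.
have n_le : (n <= i + l)%N by apply: dvdn_leq.
have [i1 [i2 [l1 [l2 [hi hl hn]]]]] : exists i1 i2 l1 l2,
    [/\ i = (i1 + i2)%N, l = (l1 + l2)%N & (i1 + l1 = n)%N].
  (* The factor s takes as many b as possible, at most [n], and is completed with u; enough are
     available since [n <= i + l]. *)
  exists (n - minn l n)%N, (i - (n - minn l n))%N, (minn l n), (l - minn l n)%N.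
  by split; lia.
have Sil : S (swap_sum i1 0 0 l1) by rewrite -(addnK l1 i1) hn; apply: Sn; lia.
subst l i.
case: (posnP (i2 + l2)) => [h0|h_gt0].
  have [-> ->] : i2 = 0%N /\ l2 = 0%N by lia.
  by rewrite !addn0.
have dv2 : (n %| i2 + l2)%N.
  by move: hm; rewrite addnACA hn dvdn_addr.
have -> : swap_sum (i1 + i2) 0 0 (l1 + l2) =
    swap_sum i1 0 0 l1 * swap_sum i2 0 0 l2 - swap_sum i2 i1 l1 l2.
  by rewrite /swap_sum !exprD; ring.
apply: SB; first (apply: SM => //; apply: IH; first lia).
  by rewrite addn0 mod0n; apply/eqP.
apply: (swap_sum_mixed IH); try lia.
by move/eqP: dv2 => ->; rewrite hn modnn.
Qed.

(** Strong induction on the degree. The lemma serves for [n = p.+1], and also for [n = 0], where the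
    congruence is an equality and the weight is exactly zero. *)
Lemma swap_sum_closed i j k l : i + l = j + k %[mod n] -> S (swap_sum i j k l).
Proof.
have [d] := ubnP (i + j + k + l); elim: d i j k l => // d IHd i j k l hd hm.
have IH : below (i + j + k + l).
  by move=> i' j' k' l' h'; apply: IHd; move: hd h'; rewrite ltnS; lia.
case: (posnP (j + k)) => [jk0|jk_gt0].
  have [j0 k0] : j = 0%N /\ k = 0%N by lia.
  by subst j k; apply: (swap_sum_pure IH); rewrite ?addn0.
case: (posnP (i + l)) => [il0|il_gt0]; last exact: (swap_sum_mixed IH).
have [i0 l0] : i = 0%N /\ l = 0%N by lia.
subst i l; rewrite swap_sumC; apply: (swap_sum_pure IH) => //.
by rewrite add0n addn0.
Qed.

End DihedralMonomials.

(** * The orthogonal group of an anisotropic plane *)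

Section TwoByTwo.
Variable R : comPzRingType.

Definition mx2 (a b c d : R) : 'M[R]_2 :=
  \matrix_(i < 2, j < 2)
    (if i == 0 then if j == 0 then a else b else if j == 0 then c else d).

Lemma mx2P (g h : 'M[R]_2) : g 0 0 = h 0 0 -> g 0 1 = h 0 1 ->
  g 1 0 = h 1 0 -> g 1 1 = h 1 1 -> g = h.
Proof.
move=> e00 e01 e10 e11; apply/matrixP.
have ordP (i : 'I_2) : i = 0 \/ i = 1.
  by case: i => [[|[|//]] lti]; [left | right]; apply: val_inj.
by move=> i j; case: (ordP i) => ->; case: (ordP j) => ->.
Qed.

Lemma mx2_eta (g : 'M[R]_2) : mx2 (g 0 0) (g 0 1) (g 1 0) (g 1 1) = g.
Proof. by apply: mx2P; rewrite mxE. Qed.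

Lemma mulmx2 a b c d a' b' c' d' : mx2 a b c d *m mx2 a' b' c' d' =
  mx2 (a * a' + b * c') (a * b' + b * d') (c * a' + d * c') (c * b' + d * d').
Proof. by apply: mx2P; rewrite !mxE !big_ord_recl big_ord0 !mxE /= addr0. Qed.

Lemma trmx2 a b c d : (mx2 a b c d)^T = mx2 a c b d.
Proof. by apply: mx2P; rewrite !mxE. Qed.

Lemma mx2_scalar1 : 1%:M = mx2 1 0 0 1.
Proof. by apply: mx2P; rewrite !mxE. Qed.

Lemma mx2_inj a b c d a' b' c' d' : mx2 a b c d = mx2 a' b' c' d' ->
  [/\ a = a', b = b', c = c' & d = d'].
Proof.
move=> /matrixP e; split; [move: (e 0 0) | move: (e 0 1) | move: (e 1 0) | move: (e 1 1)];
  by rewrite !mxE.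
Qed.

End TwoByTwo.

Section OrthogonalGroup.
Variables (p : nat) (lambda : 'F_p).
Hypothesis lam_neq0 : lambda != 0.

Lemma Dmx2 : Dmx lambda = mx2 1 0 0 (- lambda).
Proof. by apply: mx2P; rewrite !mxE. Qed.

Lemma O2minusM g h : O2minus lambda g -> O2minus lambda h -> O2minus lambda (g *m h).
Proof.
move=> /andP[Ug /eqP Dg] /andP[Uh /eqP Dh]; apply/andP; split.
  by rewrite unitmx_mul Ug.
have -> : (g *m h)^T *m Dmx lambda *m (g *m h) = h^T *m (g^T *m Dmx lambda *m g) *m h.
  by rewrite trmx_mul !mulmxA.
by rewrite Dg Dh.
Qed.

Lemma O2minusV g : O2minus lambda g -> O2minus lambda (invmx g).
Proof.
move=> /andP[Ug /eqP Dg]; apply/andP; split; first by rewrite unitmx_inv.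
by rewrite -{1}Dg !mulmxA -trmx_mul mulmxV // trmx1 mul1mx mulmxK.
Qed.

Lemma O2minusMr g h : O2minus lambda h -> O2minus lambda (g *m h) = O2minus lambda g.
Proof.
move=> Oh; apply/idP/idP => [Ogh|Og]; last exact: O2minusM.
have /andP[Uh _] := Oh.
by rewrite -(mulmxK Uh g); apply: O2minusM => //; apply: O2minusV.
Qed.

Lemma sum_O2minusMr (V : nmodType) (E : 'M['F_p]_2 -> V) h : O2minus lambda h ->
  \sum_(g | O2minus lambda g) E (g *m h) = \sum_(g | O2minus lambda g) E g.
Proof.
move=> Oh; have /andP[Uh _] := Oh.
rewrite [RHS](reindex_inj (can_inj (mulmxK Uh))).
by apply: eq_bigl => g; rewrite O2minusMr.
Qed.

Lemma O2minus_mx2 a b c d : a ^+ 2 - lambda * c ^+ 2 = 1 ->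
  a * b - lambda * (c * d) = 0 -> b ^+ 2 - lambda * d ^+ 2 = - lambda ->
  O2minus lambda (mx2 a b c d).
Proof.
move=> h1 h2 h3.
have DD : (mx2 a b c d)^T *m Dmx lambda *m mx2 a b c d = Dmx lambda.
  rewrite Dmx2 trmx2 !mulmx2; apply: mx2P; rewrite !mxE /=.
  - by rewrite -[RHS]h1; ring.
  - by rewrite -[RHS]h2; ring.
  - by rewrite -[RHS]h2; ring.
  - by rewrite -[RHS]h3; ring.
rewrite /O2minus DD eqxx andbT.
(* The left factor is D^-1 g^T D, the only possible inverse when g^T D g = D. *)
suff e : mx2 a (- lambda * c) (- b / lambda) d *m mx2 a b c d = 1%:M.
  by case: (mulmx1_unit e).
rewrite mulmx2 mx2_scalar1; congr mx2.
- by rewrite -[RHS]h1; ring.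
- by rewrite -[RHS]h2; ring.
- by apply: (mulfI lam_neq0); rewrite mulr0 -oppr0 -[in RHS]h2; field.
- by apply: (mulfI lam_neq0); rewrite mulr1 -[RHS]opprK -[in RHS]h3; field.
Qed.

(** The first triple is g^T D g = D, the second g D^-1 g^T = D^-1; the second follows because the
    left inverse D^-1 g^T D is also a right inverse. *)
Lemma O2minusP g : O2minus lambda g -> exists a b c d,
  [/\ g = mx2 a b c d, invmx g = mx2 a (- lambda * c) (- b / lambda) d,
    [/\ a ^+ 2 - lambda * c ^+ 2 = 1,
      a * b - lambda * (c * d) = 0 & b ^+ 2 - lambda * d ^+ 2 = - lambda] &
    [/\ a ^+ 2 - b ^+ 2 / lambda = 1,
      a * c - b * d / lambda = 0 & c ^+ 2 - d ^+ 2 / lambda = - lambda^-1]].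
Proof.
rewrite -(mx2_eta g); move: (g 0 0) (g 0 1) (g 1 0) (g 1 1) => a b c d /andP[Ug /eqP].
rewrite Dmx2 trmx2 !mulmx2 => /mx2_inj[e1 e2 _ e3]; exists a, b, c, d.
have h1 : a ^+ 2 - lambda * c ^+ 2 = 1 by rewrite -[RHS]e1; ring.
have h2 : a * b - lambda * (c * d) = 0 by rewrite -[RHS]e2; ring.
have h3 : b ^+ 2 - lambda * d ^+ 2 = - lambda by rewrite -[RHS]e3; ring.
have e : mx2 a (- lambda * c) (- b / lambda) d *m mx2 a b c d = 1%:M.
  rewrite mulmx2 mx2_scalar1; congr mx2.
  - by rewrite -[RHS]h1; ring.
  - by rewrite -[RHS]h2; ring.
  - by apply: (mulfI lam_neq0); rewrite mulr0 -oppr0 -[in RHS]h2; field.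
  - by apply: (mulfI lam_neq0); rewrite mulr1 -[RHS]opprK -[in RHS]h3; field.
have := mulmx1C e; rewrite mulmx2 mx2_scalar1 => /mx2_inj[d1 d2 d3 d4].
split=> //; first by rewrite -[RHS](mulmxK Ug) e mul1mx.
split.
- by rewrite -[RHS]d1; field.
- by apply: (mulfI lam_neq0); rewrite mulr0 -oppr0 -[in RHS]d2; field.
- by apply: (mulfI lam_neq0); rewrite mulrN mulfV // -[in RHS]d4; field.
Qed.

(** * Parametrization of the group by a conic *)

Hypothesis two_neq0 : 2%:R != 0 :> 'F_p.
Hypothesis lam_nonsquare : forall t : 'F_p, t ^+ 2 != lambda.

(* Stereographic projection from (1, 0) of the conic c^2 - lambda s^2 = 1. *)
Definition conic_point (o : option 'F_p) : 'F_p * 'F_p :=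
  if o is Some t then
    ((t ^+ 2 + lambda) / (t ^+ 2 - lambda), 2%:R * t / (t ^+ 2 - lambda))
  else (1, 0).

Let den_neq0 t : t ^+ 2 - lambda != 0.
Proof. by rewrite subr_eq0. Qed.

Lemma conic_pointP o : (conic_point o).1 ^+ 2 - lambda * (conic_point o).2 ^+ 2 = 1.
Proof.
case: o => [t|] /=; last by ring.
by have := den_neq0 t => dt; field.
Qed.

(** Away from the base point, c - 1 = 2 lambda / (t^2 - lambda) is nonzero, and t is recovered from
    t (c - 1) = lambda s. *)
Lemma conic_point_inj : injective conic_point.
Proof.
have neq1 t : (t ^+ 2 + lambda) / (t ^+ 2 - lambda) <> 1.
  move=> e; have := den_neq0 t => dt; move: (mulf_neq0 two_neq0 lam_neq0) => /eqP; apply.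
  have -> : 2%:R * lambda =
    ((t ^+ 2 + lambda) / (t ^+ 2 - lambda) - 1) * (t ^+ 2 - lambda) by field.
  by rewrite e subrr mul0r.
case=> [t|] [t'|] //=; last 2 first.
- by move=> /(congr1 fst) /neq1.
- by move=> /(congr1 fst) /esym /neq1.
move=> e; have /= e1 := congr1 fst e; have {e} /= e2 := congr1 snd e.
congr Some; have dt := den_neq0 t; have dt' := den_neq0 t'.
have et (x : 'F_p) : x ^+ 2 - lambda != 0 ->
    x * ((x ^+ 2 + lambda) / (x ^+ 2 - lambda) - 1) =
    lambda * (2%:R * x / (x ^+ 2 - lambda)) by move=> dx; field.
have := et _ dt; rewrite e2 -(et _ dt') e1; apply: mulIf.
by rewrite subr_eq0; apply/eqP.
Qed.

Lemma conic_point_surj c s : c ^+ 2 - lambda * s ^+ 2 = 1 ->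
  exists o, conic_point o = (c, s).
Proof.
move=> h; case: (eqVneq c 1) => [c1|cn1].
  exists None; rewrite c1; congr (_, _); apply/esym/eqP.
  have: lambda * s ^+ 2 == 0.
    have -> : lambda * s ^+ 2 = c ^+ 2 - (c ^+ 2 - lambda * s ^+ 2) by ring.
    by rewrite h c1 expr1n subrr.
  by rewrite mulf_eq0 (negPf lam_neq0) /= expf_eq0.
have c1 : c - 1 != 0 by rewrite subr_eq0.
exists (Some (lambda * s / (c - 1))) => /=.
have e : (lambda * s / (c - 1)) ^+ 2 = lambda * (c + 1) / (c - 1).
  have es : lambda * s ^+ 2 = (c + 1) * (c - 1).
    have -> : lambda * s ^+ 2 = c ^+ 2 - (c ^+ 2 - lambda * s ^+ 2) by ring.
    by rewrite h; ring.
  have -> : (lambda * s / (c - 1)) ^+ 2 = lambda * (lambda * s ^+ 2) / (c - 1) ^+ 2 by field.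
  by rewrite es; field.
by congr (_, _); apply: (canLR (mulfK (den_neq0 _))); rewrite e; field.
Qed.

Lemma O2minus_rotation c s : c ^+ 2 - lambda * s ^+ 2 = 1 ->
  O2minus lambda (mx2 c (lambda * s) s c).
Proof.
move=> h; apply: O2minus_mx2 => //; first by ring.
by rewrite -[in RHS](mulr1 lambda) -[in RHS]h; ring.
Qed.

Lemma O2minus_reflection : O2minus lambda (mx2 1 0 0 (- 1)).
Proof. by apply: O2minus_mx2; ring. Qed.

(** The first row encodes a conic point and the sign is the determinant; together they determine an
    element of the group. *)
Definition O2minus_param (q : option 'F_p * bool) : 'M['F_p]_2 :=
  let: (c, s) := conic_point q.1 in
  mx2 c (lambda * s) ((-1) ^+ q.2 * s) ((-1) ^+ q.2 * c).

Lemma O2minus_param_inj : injective O2minus_param.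
Proof.
move=> [o e] [o' e']; rewrite /O2minus_param /=.
have := @conic_point_inj o o'; have := conic_pointP o.
case: (conic_point o) (conic_point o') => [c s] [c' s'] /= h inj_o /mx2_inj[ec es es' ec'].
have {}es : s = s' by apply: (mulfI lam_neq0).
rewrite inj_o -?ec -?es //; congr (_, _).
(* Different signs would make the second row its own negative, so c = s = 0, against the conic
   equation. *)
apply/eqP; rewrite -[_ == _]negbK; apply/negP => ne.
have e2 : (-1) ^+ e' = - (-1) ^+ e :> 'F_p.
  by case: (e) (e') ne => [] [] //= _; rewrite ?expr0 ?expr1 ?opprK.
have nz x : (-1) ^+ e * x = (-1) ^+ e' * x -> x = 0 :> 'F_p.
  rewrite e2 mulNr => /eqP; rewrite -addr_eq0 -mulr2n -mulr_natl !mulf_eq0 (negPf two_neq0).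
  by rewrite signr_eq0 /= => /eqP.
move: es' ec'; rewrite -es -ec => /nz s0 /nz c0; move: h.
by rewrite s0 c0 expr0n /= mulr0 subrr => /eqP; rewrite eq_sym oner_eq0.
Qed.

Lemma O2minus_paramP g : O2minus lambda g = (g \in [set O2minus_param q | q in setT]).
Proof.
apply/idP/imsetP => [/O2minusP[a [b [c [d [-> _ [h1 h2 h3] [k1 k2 k3]]]]]] | [[o e] _ ->]].
  pose s := b / lambda.
  have [o eo] : exists o, conic_point o = (a, s).
    by apply: conic_point_surj; rewrite -[RHS]k1 /s; field.
  (* The determinant; the row relations make the second row e times (s, a). *)
  pose e := a * d - b * c.
  have ed : d = e * a.
    apply/eqP; rewrite -subr_eq0; apply/eqP.
    have -> : d - e * a = d * (1 - (a ^+ 2 - b ^+ 2 / lambda)) + b * (a * c - b * d / lambda).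
      by rewrite /e; field.
    by rewrite k1 k2; ring.
  have ec : c = e * s.
    apply/eqP; rewrite -subr_eq0; apply/eqP.
    have -> : c - e * s = c * (1 - (a ^+ 2 - b ^+ 2 / lambda)) + a * (a * c - b * d / lambda).
      by rewrite /e /s; field.
    by rewrite k1 k2; ring.
  have : e ^+ 2 = 1.
    have k3' : d ^+ 2 - lambda * c ^+ 2 = 1.
      have -> : d ^+ 2 - lambda * c ^+ 2 = - lambda * (c ^+ 2 - d ^+ 2 / lambda) by field.
      by rewrite k3; field.
    by rewrite -[RHS]k3' ed ec -[LHS]mulr1 -[in LHS]k1 /s; field.
  move/eqP; rewrite sqrf_eq1 => /orP[] /eqP e1.
    exists (o, false) => //; rewrite /O2minus_param eo expr0 !mul1r.
    by rewrite e1 mul1r in ed; rewrite e1 mul1r in ec; rewrite ed ec /s [lambda * _]mulrC divfK.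
  exists (o, true) => //; rewrite /O2minus_param eo expr1.
  by rewrite e1 in ed; rewrite e1 in ec; rewrite ed ec /s [lambda * _]mulrC divfK.
have h := conic_pointP o; rewrite /O2minus_param /=.
case: (conic_point o) h => [c s] /= h; have e1 : (-1) ^+ e * (-1) ^+ e = 1 :> 'F_p.
  by rewrite -signr_addb addbb.
apply: O2minus_mx2.
- by rewrite exprMn [((-1) ^+ e) ^+ 2]expr2 e1 mul1r.
- have -> : c * (lambda * s) - lambda * ((-1) ^+ e * s * ((-1) ^+ e * c)) =
    c * (lambda * s) - lambda * (((-1) ^+ e * (-1) ^+ e) * (s * c)) by ring.
  by rewrite e1; ring.
- have -> : (lambda * s) ^+ 2 - lambda * ((-1) ^+ e * c) ^+ 2 =
    (lambda * s) ^+ 2 - lambda * (((-1) ^+ e * (-1) ^+ e) * c ^+ 2) by ring.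
  by rewrite e1 -[in RHS](mulr1 lambda) -[in RHS]h; ring.
Qed.

(** The conic has p + 1 points, one for each t and the base point, and each occurs with both
    determinants. *)
Lemma card_O2minus : prime p -> #|O2minus lambda| = (2 * p.+1)%N.
Proof.
move=> pr_p; rewrite (eq_card (B := [set O2minus_param q | q in setT])); last first.
  by move=> g; rewrite -O2minus_paramP.
rewrite (card_imset _ O2minus_param_inj) cardsT card_prod card_option card_bool.
by rewrite card_Fp // mulnC.
Qed.

End OrthogonalGroup.

(** * The action on polynomials *)

Lemma forall_ord4 (P : 'I_4 -> Prop) : P (inord 0) -> P (inord 1) -> P (inord 2) ->
  P (inord 3) -> forall i, P i.
Proof.
move=> P0 P1 P2 P3 i; rewrite -(inord_val i).
by case: i => [[|[|[|[|//]]]] lti] /=.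
Qed.

Lemma big_ord4 (R : Type) (idx : R) (op : Monoid.law idx) (E : 'I_4 -> R) :
  \big[op/idx]_(i < 4) E i =
  op (op (op (E (inord 0)) (E (inord 1))) (E (inord 2))) (E (inord 3)).
Proof.
rewrite !big_ord_recr big_ord0 /= Monoid.mul1m.
by congr (op (op (op (E _) (E _)) (E _)) (E _)); apply: val_inj; rewrite /= inordK.
Qed.

(** Composites of substitutions are ring morphisms, so identities between them reduce to constants
    and variables. *)
Lemma eq_rmorph_mpoly n (R : comNzRingType) (S : nzRingType)
    (f g : {rmorphism {mpoly R[n]} -> S}) :
  (forall c, f c%:MP = g c%:MP) -> (forall i, f 'X_i = g 'X_i) -> f =1 g.
Proof.
move=> fC fX q; rewrite (mpolyE q) !rmorph_sum /=; apply: eq_bigr => m _.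
rewrite -mul_mpolyC !rmorphM /= fC mpolyXE_id !rmorph_prod; congr (_ * _).
by apply: eq_bigr => i _; rewrite !rmorphXn fX.
Qed.

Lemma comp_mpoly4 k (R : comNzRingType) (a b c d : {mpoly R[k]}) :
  [/\ 'X_(inord 0) \mPo [tuple a; b; c; d] = a, 'X_(inord 1) \mPo [tuple a; b; c; d] = b,
      'X_(inord 2) \mPo [tuple a; b; c; d] = c & 'X_(inord 3) \mPo [tuple a; b; c; d] = d].
Proof. by split; rewrite comp_mpolyXU inordK. Qed.

Lemma pchar_mpoly_Fp p n : prime p -> p \in [pchar {mpoly 'F_p[n]}].
Proof. by move=> pr_p; rewrite pchar_lalg pchar_Fp. Qed.

Lemma expFp p (c : 'F_p) : prime p -> c ^+ p = c.
Proof. by move=> pr_p; rewrite -{2}(expf_card c) card_Fp. Qed.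

Lemma Frobenius_add (R : comNzRingType) p (x y : R) : p \in [pchar R] ->
  (x + y) ^+ p = x ^+ p + y ^+ p.
Proof.
move=> chR; apply: exprDn_pchar; rewrite pnatE ?(pcharf_prime chR) //.
Qed.

Lemma Frobenius_opp (R : comNzRingType) p (x : R) : p \in [pchar R] ->
  (- x) ^+ p = - x ^+ p.
Proof.
move=> chR; apply/eqP; rewrite -addr_eq0 -Frobenius_add // addNr expr0n.
by rewrite gtn_eqF ?prime_gt0 ?(pcharf_prime chR).
Qed.

(** * Polarized identities behind the first five generators *)

Section QuadraticIdentities.
Variables (R : comNzRingType) (a b c d l l' : R).
Hypothesis h1 : a ^+ 2 = 1 + l * c ^+ 2.
Hypothesis h2 : a * b = l * c * d.
Hypothesis h3 : b ^+ 2 = l * d ^+ 2 - l.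
Hypothesis h4 : l * l' = 1.

(** Polarization lets one identity cover two generators: equal arguments give the quadratic form,
    and pairing (x^p, y^p) with (x, y) gives the one of degree p + 1. The difference of both sides
    is an explicit combination of the relations. *)
Lemma bilinear_form_inv x y x' y' :
  (a * x + b * y) * (a * x' + b * y') - l * ((c * x + d * y) * (c * x' + d * y')) =
  x * x' - l * (y * y').
Proof.
apply/eqP; rewrite -subr_eq0; apply/eqP.
transitivity ((a ^+ 2 - (1 + l * c ^+ 2)) * (x * x') +
  (a * b - l * c * d) * (x * y' + y * x') +
  (b ^+ 2 - (l * d ^+ 2 - l)) * (y * y')); first by ring.
by rewrite h1 h2 h3 !subrr !mul0r !addr0.
Qed.

Lemma dual_bilinear_form_inv x y x' y' :
  (a * x - b * l' * y) * (a * x' - b * l' * y') -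
  l' * ((- l * c * x + d * y) * (- l * c * x' + d * y')) =
  x * x' - l' * (y * y').
Proof.
apply/eqP; rewrite -subr_eq0; apply/eqP.
transitivity ((a ^+ 2 - (1 + l * c ^+ 2)) * (x * x') -
  (a * b - l * c * d) * (l' * (x * y' + y * x')) +
  (b ^+ 2 - (l * d ^+ 2 - l)) * (l' ^+ 2 * (y * y')) +
  (l * l' - 1) * (l' * (d ^+ 2 - 1) * (y * y') - l * c ^+ 2 * (x * x'))); first by ring.
by rewrite h1 h2 h3 h4 !subrr !mul0r subr0 !addr0.
Qed.

Lemma pairing_inv x y x' y' :
  (a * x + b * y) * (a * x' - b * l' * y') + (c * x + d * y) * (- l * c * x' + d * y') =
  x * x' + y * y'.
Proof.
apply/eqP; rewrite -subr_eq0; apply/eqP.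
transitivity ((a ^+ 2 - (1 + l * c ^+ 2)) * (x * x') +
  (a * b - l * c * d) * (y * x' - l' * (x * y')) -
  (b ^+ 2 - (l * d ^+ 2 - l)) * (l' * (y * y')) -
  (l * l' - 1) * (c * d * (x * y') + (d ^+ 2 - 1) * (y * y'))); first by ring.
by rewrite h1 h2 h3 h4 !subrr !mul0r !subr0 !addr0.
Qed.

End QuadraticIdentities.

HB.instance Definition _ p (g : 'M['F_p]_2) :=
  GRing.RMorphism.copy (@act p g) (comp_mpoly [tuple act_image g i | i < 4]).

(** * The substitution action and invariance of the generators *)

Section Action.
Variable p : nat.

Lemma actC (g : 'M['F_p]_2) c : act g c%:MP = c%:MP.
Proof. exact: comp_mpolyC. Qed.

Lemma act_X (g : 'M['F_p]_2) i : act g 'X_i = act_image g i.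
Proof. by rewrite /act comp_mpolyXU -tnth_nth tnth_mktuple. Qed.

Lemma act_mx2 (a b c d a' b' c' d' : 'F_p) :
  invmx (mx2 a b c d) = mx2 a' b' c' d' ->
  [/\ act (mx2 a b c d) (x1 p) = a%:MP * x1 p + b%:MP * x2 p,
      act (mx2 a b c d) (x2 p) = c%:MP * x1 p + d%:MP * x2 p,
      act (mx2 a b c d) (y1 p) = a'%:MP * y1 p + c'%:MP * y2 p &
      act (mx2 a b c d) (y2 p) = b'%:MP * y1 p + d'%:MP * y2 p].
Proof. by move=> e; split; rewrite act_X /act_image /= inordK // ?e !mxE. Qed.

(** Substitution reverses composition: replacing the variables by h in the linear forms given by g
    yields the matrix g h, and the contragredient part behaves likewise. *)
Lemma actM (g h : 'M['F_p]_2) f : g \in unitmx -> h \in unitmx ->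
  act h (act g f) = act (g *m h) f.
Proof.
move=> Ug Uh.
have egh : (invmx (g *m h))^T = (invmx g)^T *m (invmx h)^T.
  rewrite -trmx_mul; congr trmx.
  have e : invmx h *m invmx g *m (g *m h) = 1%:M by rewrite mulmxA mulmxKV // mulVmx.
  by rewrite -[RHS](mulmxK (_ : g *m h \in unitmx)) ?unitmx_mul ?Ug // e mul1mx.
apply: (eq_rmorph_mpoly (f := @act p h \o @act p g)) => [c|] /=; first by rewrite !actC.
have sum2 (k l : 'M['F_p]_2) i j : (k *m l) i j = k i 0 * l 0 j + k i 1 * l 1 j.
  rewrite mxE !big_ord_recl big_ord0 addr0.
  by congr (_ + k i _ * l _ j); apply: val_inj.
by apply: forall_ord4; rewrite !act_X /act_image /= inordK //= ?egh !sum2 rmorphD !rmorphM /=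
  !actC !act_X /act_image /= !inordK //=; ring.
Qed.

Lemma act_comp n (gs : n.-tuple {mpoly 'F_p[4]}) (P : {mpoly 'F_p[n]}) g :
  (forall i, act g (tnth gs i) = tnth gs i) -> act g (P \mPo gs) = P \mPo gs.
Proof.
move=> Hg; apply: (eq_rmorph_mpoly (f := @act p g \o comp_mpoly gs)) => [c|i] /=.
  by rewrite !comp_mpolyC actC.
by rewrite comp_mpolyXU -tnth_nth Hg.
Qed.

Variable lambda : 'F_p.
Hypothesis lam_neq0 : lambda != 0.
Hypothesis pr_p : prime p.

Lemma act_Tr g f : O2minus lambda g -> act g (Tr lambda f) = Tr lambda f.
Proof.
move=> Og; rewrite /Tr -[RHS](sum_O2minusMr _ Og) rmorph_sum.
by apply: eq_bigr => h Oh; case/andP: (Og) (Oh) => Ug _ /andP[Uh _]; rewrite /= actM.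
Qed.

Let Fr (x y : {mpoly 'F_p[4]}) : (x + y) ^+ p = x ^+ p + y ^+ p.
Proof. exact/Frobenius_add/pchar_mpoly_Fp. Qed.

Let FrN (x : {mpoly 'F_p[4]}) : (- x) ^+ p = - x ^+ p.
Proof. exact/Frobenius_opp/pchar_mpoly_Fp. Qed.

Let FrC (c : 'F_p) : (c%:MP_[4]) ^+ p = c%:MP.
Proof. by rewrite -rmorphXn /= expFp. Qed.

(** In degree p + 1, write x^(p+1) = x^p x. The p-th power map is additive and fixes constants of
    F_p, so the p-th powers of the variables transform by the same matrix as the variables. *)
Lemma act_gen g k : O2minus lambda g -> act g (gen lambda k) = gen lambda k.
Proof.
move=> Og.
have [a [b [c [d [eg eV [h1 h2 h3] _]]]]] := O2minusP lam_neq0 Og.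
rewrite eg in eV; have := act_mx2 eV; rewrite -eg => -[gx1 gx2 gy1 gy2].
have {}h1 : a ^+ 2 = 1 + lambda * c ^+ 2 by rewrite -[in RHS]h1; ring.
have {}h2 : a * b = lambda * c * d by apply/eqP; rewrite -subr_eq0 -mulrA h2.
have {}h3 : b ^+ 2 = lambda * d ^+ 2 - lambda by rewrite -[in RHS]h3; ring.
have LL : (lambda%:MP_[4]) * (lambda^-1)%:MP = 1 by rewrite -rmorphM /= mulfV.
have H1 : a%:MP_[4] ^+ 2 = 1 + lambda%:MP * c%:MP ^+ 2.
  by rewrite -rmorphXn /= h1 rmorphD rmorph1 rmorphM rmorphXn.
have H2 : a%:MP_[4] * b%:MP = lambda%:MP * c%:MP * d%:MP.
  by rewrite -rmorphM /= h2 !rmorphM.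
have H3 : b%:MP_[4] ^+ 2 = lambda%:MP * d%:MP ^+ 2 - lambda%:MP.
  by rewrite -rmorphXn /= h3 rmorphB rmorphM rmorphXn.
have {}gy1 : act g (y1 p) = a%:MP * y1 p - b%:MP * lambda^-1%:MP * y2 p.
  by rewrite gy1 mulNr rmorphN rmorphM /= mulNr.
have {}gy2 : act g (y2 p) = - lambda%:MP * c%:MP * y1 p + d%:MP * y2 p.
  by rewrite gy2 rmorphM rmorphN.
rewrite /gen; case: (val k) => [|[|[|[|[|j]]]]]; last exact: act_Tr;
  rewrite !(rmorphB, rmorphD, rmorphM, rmorphXn) /= ?actC ?gx1 ?gx2 ?gy1 ?gy2.
- exact: bilinear_form_inv.
- rewrite !exprSr !Fr !exprMn !FrC; exact: bilinear_form_inv.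
- exact: dual_bilinear_form_inv.
- rewrite !exprSr !Fr !FrN !exprMn !FrN !FrC; exact: dual_bilinear_form_inv.
- exact: pairing_inv.
Qed.

End Action.

(** * Diagonalizing the rotations *)

Definition subalg_gen (L : comNzRingType) k n (gs : n.-tuple {mpoly L[k]})
  (f : {mpoly L[k]}) : Prop := exists Q : {mpoly L[n]}, f = Q \mPo gs.

Section SubalgGen.
Variables (L : comNzRingType) (k n : nat) (gs : n.-tuple {mpoly L[k]}).
Notation S := (subalg_gen gs).

Lemma subalg_genC c : S c%:MP.
Proof. by exists c%:MP; rewrite comp_mpolyC. Qed.

Lemma subalg_gen1 : S 1.
Proof. exact: subalg_genC. Qed.

Lemma subalg_gen_tnth i : S (tnth gs i).
Proof. by exists 'X_i; rewrite comp_mpolyXU -tnth_nth. Qed.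

Lemma subalg_genD f g : S f -> S g -> S (f + g).
Proof. by move=> [P ->] [Q ->]; exists (P + Q); rewrite rmorphD. Qed.

Lemma subalg_genB f g : S f -> S g -> S (f - g).
Proof. by move=> [P ->] [Q ->]; exists (P - Q); rewrite rmorphB. Qed.

Lemma subalg_genM f g : S f -> S g -> S (f * g).
Proof. by move=> [P ->] [Q ->]; exists (P * Q); rewrite rmorphM. Qed.

Lemma subalg_gen_sum (I : Type) (r : seq I) (P : pred I) (E : I -> {mpoly L[k]}) :
  (forall i, P i -> S (E i)) -> S (\sum_(i <- r | P i) E i).
Proof. by apply: big_ind; [exact: (subalg_genC 0) | exact: subalg_genD]. Qed.

End SubalgGen.

Lemma subalg_gen_unit (L : fieldType) k n (gs : n.-tuple {mpoly L[k]}) (c : L) f :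
  c != 0 -> subalg_gen gs (c%:MP * f) -> subalg_gen gs f.
Proof.
move=> c0 Sf; rewrite -[f]mul1r -[1](rmorph1 (@mpolyC k L)) -(mulVf c0) rmorphM /= -mulrA.
by apply: subalg_genM => //; apply: subalg_genC.
Qed.

Section Diagonalization.
Variables (p : nat) (lambda : 'F_p) (L : fieldType).
Variables (iota : {rmorphism 'F_p -> L}) (w : L).
Hypothesis pr_p : prime p.
Hypothesis two_neq0 : 2%:R != 0 :> 'F_p.
Hypothesis lam_neq0 : lambda != 0.
Hypothesis lam_nonsquare : forall t : 'F_p, t ^+ 2 != lambda.
Hypothesis w_sqr : w ^+ 2 = iota lambda.
Hypothesis w_Frob : w ^+ p = - w.

Let iota_inj : injective iota.
Proof. exact: fmorph_inj. Qed.

Let w_neq0 : w != 0.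
Proof.
have : w ^+ 2 != 0 by rewrite w_sqr fmorph_eq0.
by apply: contraNneq => ->; rewrite expr0n.
Qed.

Let two_neq0L : 2%:R != 0 :> L.
Proof. by rewrite -(rmorph_nat iota) fmorph_eq0. Qed.

Let pcharL : p \in [pchar L].
Proof. by rewrite (fmorph_pchar iota) pchar_Fp. Qed.

Let FrL (x y : L) : (x + y) ^+ p = x ^+ p + y ^+ p.
Proof. exact: Frobenius_add. Qed.

Let FrNL (x : L) : (- x) ^+ p = - x ^+ p.
Proof. exact: Frobenius_opp. Qed.

Let FrC (c : 'F_p) : iota c ^+ p = iota c.
Proof. by rewrite -rmorphXn /= expFp. Qed.

(** * Norm-one elements c + s w *)

Definition norm_elt (c s : 'F_p) : L := iota c + iota s * w.
Definition norm_conj (c s : 'F_p) : L := iota c - iota s * w.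

(** As w^p = -w, the p-th power map is conjugation, so norm 1 means z^(p+1) = 1. *)
Lemma norm_elt_Frob c s : norm_elt c s ^+ p = norm_conj c s.
Proof. by rewrite FrL exprMn !FrC w_Frob mulrN. Qed.

Lemma norm_conj_Frob c s : norm_conj c s ^+ p = norm_elt c s.
Proof. by rewrite FrL FrNL exprMn !FrC w_Frob mulrN opprK. Qed.

Lemma norm_eltM c s : norm_elt c s * norm_conj c s = iota (c ^+ 2 - lambda * s ^+ 2).
Proof.
rewrite rmorphB rmorphXn rmorphM rmorphXn /= -w_sqr /norm_elt /norm_conj.
by ring.
Qed.

Lemma norm_elt_inj c s c' s' : norm_elt c s = norm_elt c' s' -> c = c' /\ s = s'.
Proof.
move=> e; have := congr1 (fun x => x ^+ p) e; rewrite /= !norm_elt_Frob => e'.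
split; apply: iota_inj; apply: (mulfI two_neq0L).
  have eC x y : 2%:R * iota x = norm_elt x y + norm_conj x y.
    by rewrite /norm_elt /norm_conj; ring.
  by rewrite (eC c s) (eC c' s') e e'.
apply: (mulIf w_neq0); have eS x y : 2%:R * iota y * w = norm_elt x y - norm_conj x y.
  by rewrite /norm_elt /norm_conj; ring.
by rewrite (eS c s) (eS c' s') e e'.
Qed.

(** The p + 1 conic points give distinct elements, and at most r of them are roots of X^r - 1. *)
Lemma norm_elt_separates r : (0 < r < p.+1)%N ->
  exists c s, c ^+ 2 - lambda * s ^+ 2 = 1 /\ norm_elt c s ^+ r != 1.
Proof.
move=> /andP[r_gt0 r_lt].
pose z o := norm_elt (conic_point lambda o).1 (conic_point lambda o).2.
case: (boolP [forall o, z o ^+ r == 1]) => [/forallP z1|]; last first.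
  case/forallPn => o zo; exists (conic_point lambda o).1, (conic_point lambda o).2.
  by split=> //; apply: conic_pointP.
have inj_z : injective z.
  move=> o o' /norm_elt_inj[e1 e2].
  apply: (conic_point_inj lam_neq0 two_neq0 lam_nonsquare).
  by rewrite [LHS]surjective_pairing e1 e2 -surjective_pairing.
have := @max_unity_roots _ r [seq z o | o : option 'F_p] r_gt0.
rewrite size_map -cardE card_option card_Fp // map_inj_uniq // enum_uniq.
rewrite leqNgt r_lt => H; exfalso; suff // : false by [].
apply: H => //; apply/allP => x /mapP[o _ ->]; rewrite unity_rootE; exact: z1.
Qed.

(** The conjugate of z is z^p, so z^(i + p j) = 1 for all z of norm 1, and by separation p + 1
    divides i + p j; finally p is -1 modulo p + 1. *)
Lemma weight_eq_mod i j :
  (forall c s, c ^+ 2 - lambda * s ^+ 2 = 1 -> norm_elt c s ^+ i * norm_conj c s ^+ j = 1) ->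
  i = j %[mod p.+1].
Proof.
have zn c s : c ^+ 2 - lambda * s ^+ 2 = 1 -> norm_elt c s ^+ p.+1 = 1.
  by move=> h; rewrite exprS norm_elt_Frob norm_eltM h rmorph1.
move=> H; pose r := ((i + p * j) %% p.+1)%N.
have Hr c s : c ^+ 2 - lambda * s ^+ 2 = 1 -> norm_elt c s ^+ r = 1.
  move=> h; rewrite -(H c s h) -norm_elt_Frob -exprM -exprD /r.
  by rewrite [in RHS](divn_eq (i + p * j) p.+1) exprD [(_ %/ _ * _)%N]mulnC exprM zn // expr1n mul1r.
have : r = 0%N.
  apply/eqP; rewrite -leqn0 leqNgt; apply/negP => r_gt0.
  have [|c [s [h /eqP]]] := @norm_elt_separates r; first by rewrite r_gt0 ltn_pmod.
  by apply; apply: Hr.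
rewrite /r => e; apply/eqP; rewrite -(eqn_modDr (p * j)) -mulSn modnMr e.
by rewrite eqxx.
Qed.

Notation P := {mpoly L[4]}.
Local Notation U := ('X_(inord 0) : P).
Local Notation V := ('X_(inord 1) : P).
Local Notation A := ('X_(inord 2) : P).
Local Notation B := ('X_(inord 3) : P).
Local Notation h := ((2%:R^-1 : L)%:MP_[4]).
Local Notation W := (w%:MP_[4]).
Local Notation Wi := (w^-1%:MP_[4]).

(* U, V, A, B stand for the eigenvectors x1 + w x2, x1 - w x2, y1 + y2 / w and
   y1 - y2 / w of the rotation subgroup. *)
Definition diagonalize (f : {mpoly 'F_p[4]}) : P :=
  map_mpoly iota f \mPo
    [tuple h * (U + V); h * Wi * (U - V); h * (A + B); h * W * (A - B)].

HB.instance Definition _ := GRing.RMorphism.copy diagonalize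
  (comp_mpoly [tuple h * (U + V); h * Wi * (U - V); h * (A + B); h * W * (A - B)]
     \o map_mpoly iota).

Lemma diagonalizeC c : diagonalize c%:MP = (iota c)%:MP.
Proof. by rewrite /diagonalize map_mpolyC comp_mpolyC. Qed.

Lemma diagonalizeX : [/\ diagonalize (x1 p) = h * (U + V),
  diagonalize (x2 p) = h * Wi * (U - V), diagonalize (y1 p) = h * (A + B) &
  diagonalize (y2 p) = h * W * (A - B)].
Proof.
rewrite /diagonalize !map_mpolyX.
by case: (comp_mpoly4 (h * (U + V)) (h * Wi * (U - V)) (h * (A + B)) (h * W * (A - B))).
Qed.

Lemma mpolyC_half : h + h = 1.
Proof.
have e : 2%:R^-1 + 2%:R^-1 = 1 :> L by rewrite -[RHS](divff two_neq0L); ring.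
by rewrite -rmorphD /= e rmorph1.
Qed.

Lemma mpolyC_divff : W * Wi = 1.
Proof. by rewrite -rmorphM /= divff // rmorph1. Qed.

Lemma mpolyC_sqr : W * W = (iota lambda)%:MP.
Proof. by rewrite -rmorphM /= -expr2 w_sqr. Qed.


Lemma diagonalize_rotation c s f : c ^+ 2 - lambda * s ^+ 2 = 1 ->
  diagonalize (act (mx2 c (lambda * s) s c) f) =
  diagonalize f \mPo [tuple (norm_elt c s)%:MP * U; (norm_conj c s)%:MP * V;
                            (norm_conj c s)%:MP * A; (norm_elt c s)%:MP * B].
Proof.
move=> hcs; pose r := mx2 c (lambda * s) s c.
have [a [b [c' [d [/mx2_inj[<- <- <- <-] eV _ _]]]]] :=
  O2minusP lam_neq0 (O2minus_rotation lam_neq0 hcs).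
have [rx1 rx2 ry1 ry2] := act_mx2 eV.
have [dx1 dx2 dy1 dy2] := diagonalizeX.
set sc := [tuple _; _; _; _].
have [sU sV sA sB] := comp_mpoly4 ((norm_elt c s)%:MP * U) ((norm_conj c s)%:MP * V)
  ((norm_conj c s)%:MP * A) ((norm_elt c s)%:MP * B).
have zE : (norm_elt c s)%:MP_[4] = (iota c)%:MP + (iota s)%:MP * W.
  by rewrite /norm_elt rmorphD rmorphM.
have zE' : (norm_conj c s)%:MP_[4] = (iota c)%:MP - (iota s)%:MP * W.
  by rewrite /norm_conj rmorphB rmorphM.
have WL : (iota lambda)%:MP * Wi = W by rewrite -mpolyC_sqr -mulrA mpolyC_divff mulr1.
apply: (eq_rmorph_mpoly (f := diagonalize \o act r) (g := comp_mpoly sc \o diagonalize)).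
  by move=> x /=; rewrite actC !diagonalizeC comp_mpolyC.
apply: forall_ord4 => /=.
- rewrite rx1 dx1 rmorphD !rmorphM /= !diagonalizeC dx1 dx2 rmorphD /= sU sV comp_mpolyC.
  rewrite zE zE' -WL.
  ring.
- rewrite rx2 dx2 rmorphD !rmorphM /= !diagonalizeC dx1 dx2 rmorphB /= sU sV !comp_mpolyC.
  rewrite zE zE'.
  ring: mpolyC_divff.
- have e : - (lambda * s) / lambda = - s by field.
  rewrite ry1 e dy1 rmorphD !rmorphM /= !diagonalizeC dy1 dy2 rmorphD /= sA sB comp_mpolyC.
  rewrite zE zE'.
  ring.
- rewrite ry2 dy2 rmorphD !rmorphM /= !diagonalizeC dy1 dy2 rmorphB /= sA sB !comp_mpolyC.
  rewrite zE zE'.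
  ring: mpolyC_sqr.
Qed.

Lemma diagonalize_reflection f : diagonalize (act (mx2 1 0 0 (- 1)) f) =
  diagonalize f \mPo [tuple V; U; B; A].
Proof.
have [a [b [c' [d [/mx2_inj[<- <- <- <-] eV _ _]]]]] :=
  O2minusP lam_neq0 (O2minus_reflection lam_neq0).
have [rx1 rx2 ry1 ry2] := act_mx2 eV.
have [dx1 dx2 dy1 dy2] := diagonalizeX.
have [sU sV sA sB] := comp_mpoly4 V U B A.
apply: (eq_rmorph_mpoly (f := diagonalize \o act (mx2 1 0 0 (- 1)))
  (g := comp_mpoly [tuple V; U; B; A] \o diagonalize)).
  by move=> x /=; rewrite actC !diagonalizeC comp_mpolyC.
apply: forall_ord4 => /=.
- rewrite rx1 dx1 rmorphD !rmorphM /= !diagonalizeC dx1 dx2 rmorphD /= sU sV comp_mpolyC.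
  ring.
- rewrite rx2 dx2 rmorphD !rmorphM /= !diagonalizeC dx1 dx2 rmorphB /= sU sV !comp_mpolyC.
  ring.
- rewrite ry1 oppr0 mul0r dy1 rmorphD !rmorphM /= !diagonalizeC dy1 dy2 rmorphD /= sA sB comp_mpolyC.
  ring.
- rewrite ry2 dy2 rmorphD !rmorphM /= !diagonalizeC dy1 dy2 rmorphB /= sA sB !comp_mpolyC.
  ring.
Qed.

Lemma mpolyX4 (m : 'X_{1..4}) : 'X_[m] = U ^+ m (inord 0) * V ^+ m (inord 1) *
  A ^+ m (inord 2) * B ^+ m (inord 3).
Proof. by rewrite mpolyXE_id big_ord4. Qed.

(** Each monomial is an eigenvector of every rotation. Comparing coefficients in an invariant forces
    the eigenvalue to be 1 on its support. *)
Lemma invariant_weight f m : O2_invariant lambda f -> m \in msupp (diagonalize f) ->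
  m (inord 0) + m (inord 3) = m (inord 1) + m (inord 2) %[mod p.+1].
Proof.
move=> f_inv m_supp; apply: weight_eq_mod => c s hcs.
have := diagonalize_rotation f hcs.
rewrite f_inv; last exact: O2minus_rotation.
set H := diagonalize f in m_supp *; set z := norm_elt c s; set z' := norm_conj c s => eH.
have [sU sV sA sB] := comp_mpoly4 (z%:MP * U) (z'%:MP * V) (z'%:MP * A) (z%:MP * B).
pose k (m' : 'X_{1..4}) : L :=
  z ^+ (m' (inord 0) + m' (inord 3)) * z' ^+ (m' (inord 1) + m' (inord 2)).
have eX m' : 'X_[m'] \mPo [tuple z%:MP * U; z'%:MP * V; z'%:MP * A; z%:MP * B] =
    k m' *: 'X_[m'].
  rewrite (mpolyX4 m') !rmorphM !rmorphXn /= sU sV sA sB -mul_mpolyC /k !exprD !rmorphM !rmorphXn /=.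
  by rewrite !exprMn; ring.
have Hm : H@_m = H@_m * k m.
  rewrite {1}eH {1}(mpolyE H) rmorph_sum /= raddf_sum /=.
  rewrite (bigD1_seq m) ?msupp_uniq //= big1_seq => [|m' /andP[/negPf mm' _]].
    by rewrite comp_mpolyZ eX !mcoeffZ mcoeffX eqxx mulr1 addr0.
  by rewrite comp_mpolyZ eX !mcoeffZ mcoeffX mm' !mulr0.
apply: (@mulfI _ H@_m); first by rewrite -mcoeff_msupp.
by rewrite mulr1.
Qed.


(** * Expansion of the traces in eigenvector coordinates *)

Definition row_elt (g : 'M['F_p]_2) : L := norm_elt (g 0 0) (g 0 1 / lambda).
(** Up to a factor 1/2, [row_elt g] and [row_conj g] are the coordinates on [U] and [V] of the image
    of x1 under [g], and those on [B] and [A] of the image of y1. *)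
Definition row_conj (g : 'M['F_p]_2) : L := norm_conj (g 0 0) (g 0 1 / lambda).

Lemma row_eltX g : O2minus lambda g ->
  row_elt g ^+ p.+1 = 1 /\ row_conj g ^+ p.+1 = 1.
Proof.
move=> /(O2minusP lam_neq0)[a [b [c [d [-> _ _ [k1 _ _]]]]]].
rewrite /row_elt /row_conj !mxE /= !exprS norm_elt_Frob norm_conj_Frob [norm_conj _ _ * _]mulrC.
have e : a ^+ 2 - lambda * (b / lambda) ^+ 2 = 1 by rewrite -[RHS]k1; field.
by rewrite norm_eltM e rmorph1.
Qed.

Lemma row_elt_rotation g c s :
  row_elt (g *m mx2 c (lambda * s) s c) = row_elt g * norm_elt c s /\
  row_conj (g *m mx2 c (lambda * s) s c) = row_conj g * norm_conj c s.
Proof.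
rewrite -(mx2_eta g) mulmx2 /row_elt /row_conj !mxE /=.
have e : (g 0 0 * (lambda * s) + g 0 1 * c) / lambda = g 0 0 * s + g 0 1 / lambda * c by field.
have e' : g 0 1 = lambda * (g 0 1 / lambda) by field.
rewrite e [X in _ + X * s]e' /norm_elt /norm_conj !(rmorphD, rmorphM) /= -w_sqr.
by split; ring.
Qed.

Lemma row_elt_reflection g :
  row_elt (g *m mx2 1 0 0 (- 1)) = row_conj g /\
  row_conj (g *m mx2 1 0 0 (- 1)) = row_elt g.
Proof.
rewrite -(mx2_eta g) mulmx2 /row_elt /row_conj !mxE /=.
rewrite !mulr1 !mulr0 addr0 add0r mulrN1 mulNr /norm_elt /norm_conj rmorphN mulNr opprK.
by [].
Qed.

Definition row_power_sum d : L :=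
  \sum_(g | O2minus lambda g) row_elt g ^+ d * row_conj g ^+ (p.+1 - d).

(** With n = p + 1, translation by a rotation multiplies the sum by z^d times the (n - d)-th power
    of the conjugate of z. If the sum is nonzero, this factor is always 1, so d and n - d agree
    modulo n and hence are equal. *)
Lemma row_power_sum_eq0 d : (0 < d < p.+1)%N -> d != (p.+1 - d)%N -> row_power_sum d = 0.
Proof.
move=> /andP[d_gt0 d_lt] nd; apply/eqP; apply: contraNT nd => E0; apply/eqP.
suff : d = p.+1 - d %[mod p.+1] by rewrite !modn_small //; lia.
apply: weight_eq_mod => c s hcs; apply: (mulfI E0); rewrite mulr1.
rewrite /row_power_sum -[RHS](sum_O2minusMr _ (O2minus_rotation lam_neq0 hcs)) mulr_suml.
apply: eq_bigr => g _; have [-> ->] := row_elt_rotation g c s.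
by rewrite !exprMn; ring.
Qed.

(** Here every summand is 1, so the sum is the group order 2(p + 1), which is 2 in characteristic
    p. *)
Lemma row_power_sum_ends :
  row_power_sum p.+1 = iota 2%:R /\ row_power_sum 0 = iota 2%:R.
Proof.
have cst : \sum_(g | O2minus lambda g) (1 : L) = iota 2%:R.
  rewrite sumr_const (card_O2minus lam_neq0 two_neq0 lam_nonsquare pr_p).
  by rewrite mulnS natrD natrM (pcharf0 pcharL) mulr0 addr0 rmorph_nat.
by split; rewrite /row_power_sum -cst; apply: eq_bigr => g /row_eltX[e e'];
  rewrite ?subnn ?subn0 ?expr0 ?mulr1 ?mul1r.
Qed.

(** The diagonalized trace up to a power of 2, with the eigenvectors as parameters so that they can
    be exchanged. *)
Definition row_expansion (u v a b : P) N i : P :=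
  \sum_(g | O2minus lambda g)
    ((row_elt g)%:MP * u + (row_conj g)%:MP * v) ^+ N *
    ((row_conj g)%:MP * a + (row_elt g)%:MP * b) ^+ i.

Lemma row_expansion_swap u v a b N i :
  row_expansion v u b a N i = row_expansion u v a b N i.
Proof.
rewrite /row_expansion -[RHS](sum_O2minusMr _ (O2minus_reflection lam_neq0)).
apply: eq_bigr => g _; have [-> ->] := row_elt_reflection g.
by congr (_ ^+ _ * _ ^+ _); rewrite addrC.
Qed.

(** In the two binomial expansions u and b carry [row_elt] while v and a carry [row_conj]; the
    exponents of these add up to N + i = p + 1. *)
Lemma row_expansionE u v a b N i : (N + i = p.+1)%N -> row_expansion u v a b N i =
  \sum_(j < N.+1) \sum_(k < i.+1) ((row_power_sum (N - j + k))%:MP *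
    (u ^+ (N - j) * v ^+ j * a ^+ (i - k) * b ^+ k)) *+ ('C(i, k) * 'C(N, j)).
Proof.
move=> Ni; rewrite /row_expansion.
under eq_bigr => g _ do rewrite !exprDn big_distrlr.
rewrite exchange_big /=; apply: eq_bigr => j _.
rewrite exchange_big /=; apply: eq_bigr => k _.
rewrite /row_power_sum rmorph_sum /= mulr_suml -sumrMnl; apply: eq_bigr => g _.
have -> : (p.+1 - (N - j + k) = j + (i - k))%N.
  by have := ltn_ord j; have := ltn_ord k; lia.
have mulrnM (x y : P) m n : (x *+ m) * (y *+ n) = (x * y) *+ (n * m).
  by rewrite mulrnAl mulrnAr mulrnA.
rewrite mulrnM; apply: (congr1 (fun t : P => t *+ _)).
by rewrite !exprMn !exprD !rmorphM !rmorphXn /=; ring.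
Qed.

Lemma diagonalize_Tr N i : (N + i = p.+1)%N ->
  diagonalize (Tr lambda (x1 p ^+ N * y1 p ^+ i)) =
  h ^+ p.+1 * row_expansion U V A B N i.
Proof.
move=> Ni; rewrite /Tr rmorph_sum /row_expansion mulr_sumr; apply: eq_bigr => g Og /=.
have [a [b [c [d [eg eV _ _]]]]] := O2minusP lam_neq0 Og.
rewrite eg in eV *; have [gx1 _ gy1 _] := act_mx2 eV.
have [dx1 dx2 dy1 dy2] := diagonalizeX.
have WL : (iota lambda)%:MP * Wi = W by rewrite -mpolyC_sqr -mulrA mpolyC_divff mulr1.
rewrite /row_elt /row_conj !mxE /= -Ni exprD.
have [s es] : exists s, b = lambda * s by exists (b / lambda); field.
have e : b / lambda = s by rewrite es; field.
have e' : - b / lambda = - s by rewrite mulNr e.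
have zE : (norm_elt a s)%:MP_[4] = (iota a)%:MP + (iota s)%:MP * W.
  by rewrite /norm_elt rmorphD rmorphM.
have zE' : (norm_conj a s)%:MP_[4] = (iota a)%:MP - (iota s)%:MP * W.
  by rewrite /norm_conj rmorphB rmorphM.
have ex : diagonalize (a%:MP * x1 p + b%:MP * x2 p) =
    h * ((norm_elt a s)%:MP * U + (norm_conj a s)%:MP * V).
  rewrite rmorphD !rmorphM /= !diagonalizeC dx1 dx2 es rmorphM zE zE' -WL rmorphM /=.
  by ring.
have ey : diagonalize (a%:MP * y1 p + (- b / lambda)%:MP * y2 p) =
    h * ((norm_conj a s)%:MP * A + (norm_elt a s)%:MP * B).
  rewrite e' rmorphD !rmorphM /= !diagonalizeC dy1 dy2 zE zE' !rmorphN /=.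
  by ring.
by rewrite !rmorphM !rmorphXn /= gx1 gy1 ex ey e !exprMn; ring.
Qed.


(** * The generators in eigenvector coordinates *)

Definition diagonal_gens : (5 + p).-tuple P :=
  [tuple diagonalize (tnth (gens lambda) k) | k < 5 + p].
Notation S := (subalg_gen diagonal_gens).

Lemma diagonal_gens_gen k : S (diagonalize (gen lambda k)).
Proof. by have := subalg_gen_tnth diagonal_gens k; rewrite !tnth_mktuple. Qed.

Let lamWi : (iota lambda)%:MP * Wi ^+ 2 = 1.
Proof. by rewrite -mpolyC_sqr -expr2 -exprMn mpolyC_divff expr1n. Qed.

Let ilamW : (iota lambda^-1)%:MP * W ^+ 2 = 1.
Proof. by rewrite expr2 mpolyC_sqr -rmorphM /= -rmorphM /= mulVf // !rmorph1. Qed.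

Let FrP (x y : P) : (x + y) ^+ p = x ^+ p + y ^+ p.
Proof. by apply: Frobenius_add; rewrite pchar_lalg. Qed.

Let FrNP (x : P) : (- x) ^+ p = - x ^+ p.
Proof. by apply: Frobenius_opp; rewrite pchar_lalg. Qed.

Let Frh : h ^+ p = h.
Proof. by rewrite -rmorphXn /= exprVn -(rmorph_nat iota) FrC. Qed.

Let FrW : W ^+ p = - W.
Proof. by rewrite -rmorphXn /= w_Frob rmorphN. Qed.

Let FrWi : Wi ^+ p = - Wi.
Proof. by rewrite -rmorphXn /= exprVn w_Frob invrN rmorphN. Qed.

Lemma diagonal_gens_UV : S (U * V).
Proof.
have [dx1 dx2 dy1 dy2] := diagonalizeX.
have := diagonal_gens_gen (Ordinal (isT : (0 < 5 + p)%N)).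
rewrite /gen /= rmorphB rmorphXn rmorphM rmorphXn /= diagonalizeC dx1 dx2 => H; move: H.
congr S; transitivity ((h + h) * (h + h) * (U * V)); last by rewrite mpolyC_half !mul1r.
have -> : (iota lambda)%:MP * (h * Wi * (U - V)) ^+ 2 =
  (iota lambda)%:MP * Wi ^+ 2 * (h * (U - V)) ^+ 2 by ring.
by rewrite lamWi; ring.
Qed.

Lemma diagonal_gens_AB : S (A * B).
Proof.
have [dx1 dx2 dy1 dy2] := diagonalizeX.
have := diagonal_gens_gen (Ordinal (isT : (2 < 5 + p)%N)).
rewrite /gen /= rmorphB rmorphXn rmorphM rmorphXn /= diagonalizeC dy1 dy2 => H; move: H.
congr S; transitivity ((h + h) * (h + h) * (A * B)); last by rewrite mpolyC_half !mul1r.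
have -> : (iota lambda^-1)%:MP * (h * W * (A - B)) ^+ 2 =
  (iota lambda^-1)%:MP * W ^+ 2 * (h * (A - B)) ^+ 2 by ring.
by rewrite ilamW; ring.
Qed.

Lemma diagonal_gens_pairing : S (U * A + V * B).
Proof.
have [dx1 dx2 dy1 dy2] := diagonalizeX.
apply: (@subalg_gen_unit _ _ _ _ 2%:R^-1); first by rewrite invr_eq0.
have := diagonal_gens_gen (Ordinal (isT : (4 < 5 + p)%N)).
rewrite /gen /= rmorphD !rmorphM /= dx1 dx2 dy1 dy2 => H; move: H.
congr S; transitivity ((h + h) * (h * (U * A + V * B))); last by rewrite mpolyC_half mul1r.
have -> : h * Wi * (U - V) * (h * W * (A - B)) =
  (W * Wi) * (h * (U - V) * (h * (A - B))) by ring.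
by rewrite mpolyC_divff; ring.
Qed.

(** As w^p = -w, the x2 term has the opposite sign to the quadratic case: the mixed products U V^p
    and V U^p cancel, leaving half the wanted sum. *)
Lemma diagonal_gens_power_x : S (U ^+ p.+1 + V ^+ p.+1).
Proof.
have [dx1 dx2 dy1 dy2] := diagonalizeX.
apply: (@subalg_gen_unit _ _ _ _ 2%:R^-1); first by rewrite invr_eq0.
have := diagonal_gens_gen (Ordinal (isT : (1 < 5 + p)%N)).
rewrite /gen /= rmorphB rmorphXn rmorphM rmorphXn /= diagonalizeC dx1 dx2 => H; move: H.
rewrite !exprS !exprMn !FrP FrNP Frh FrWi.
congr S; transitivity ((h + h) * (h * (U * U ^+ p + V * V ^+ p))); last first.
  by rewrite mpolyC_half mul1r.
have -> : (iota lambda)%:MP * (h * Wi * (U - V) * (h * - Wi * (U ^+ p - V ^+ p))) =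
  - ((iota lambda)%:MP * Wi ^+ 2) * (h * (U - V) * (h * (U ^+ p - V ^+ p))) by ring.
by rewrite lamWi; ring.
Qed.

Lemma diagonal_gens_power_y : S (A ^+ p.+1 + B ^+ p.+1).
Proof.
have [dx1 dx2 dy1 dy2] := diagonalizeX.
apply: (@subalg_gen_unit _ _ _ _ 2%:R^-1); first by rewrite invr_eq0.
have := diagonal_gens_gen (Ordinal (isT : (3 < 5 + p)%N)).
rewrite /gen /= rmorphB rmorphXn rmorphM rmorphXn /= diagonalizeC dy1 dy2 => H; move: H.
rewrite !exprS !exprMn !FrP FrNP Frh FrW.
congr S; transitivity ((h + h) * (h * (A * A ^+ p + B * B ^+ p))); last first.
  by rewrite mpolyC_half mul1r.
have -> : (iota lambda^-1)%:MP * (h * W * (A - B) * (h * - W * (A ^+ p - B ^+ p))) =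
  - ((iota lambda^-1)%:MP * W ^+ 2) * (h * (A - B) * (h * (A ^+ p - B ^+ p))) by ring.
by rewrite ilamW; ring.
Qed.

(** Taking modulus 0 leaves only 1 + 1 to check in place of the traces, so this is available before
    the traces are treated. *)
Lemma diagonal_gens_weight0 i j k l : (i + l = j + k)%N -> S (swap_sum U V A B i j k l).
Proof.
move=> e; apply: (@swap_sum_closed _ S _ _ _ _ 0); rewrite ?e //.
- exact: subalg_gen1.
- exact: subalg_genB.
- exact: subalg_genM.
- exact: diagonal_gens_UV.
- exact: diagonal_gens_AB.
- exact: diagonal_gens_pairing.
- move=> m; rewrite leqn0 => /eqP ->; rewrite /swap_sum !expr0 !mulr1.
  by apply: subalg_genD; apply: subalg_gen1.
Qed.

Lemma gen_Tr i (lti : (4 + i.+1 < 5 + p)%N) :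
  gen lambda (Ordinal lti) = Tr lambda (x1 p ^+ (p.+1 - i.+1) * y1 p ^+ i.+1).
Proof.
transitivity (Tr lambda (x1 p ^+ (p + 1 - (4 + i.+1 - 4)) * y1 p ^+ (4 + i.+1 - 4))).
  reflexivity.
by rewrite addKn addn1.
Qed.

(** In the expanded trace only the two extreme terms and terms of weight zero survive; the latter
    are already in the subalgebra, so the former can be solved for. *)
Lemma diagonal_gens_Tr i : (0 < i < p.+1)%N -> S (swap_sum U V A B (p.+1 - i) 0 0 i).
Proof.
move=> /andP[i_gt0 i_lt]; set N := (p.+1 - i)%N.
have Ni : (N + i = p.+1)%N by rewrite /N; lia.
have N_gt0 : (0 < N)%N by lia.
have h0 : (2%:R^-1 : L) ^+ p.+1 != 0 by rewrite expf_neq0 // invr_eq0.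
have SR : S (row_expansion U V A B N i).
  apply: (subalg_gen_unit h0); rewrite rmorphXn -diagonalize_Tr //.
  have [k ek] : exists k, i = k.+1 by exists i.-1; lia.
  have ltk : (4 + k.+1 < 5 + p)%N by lia.
  by rewrite /N ek -(gen_Tr ltk); apply: diagonal_gens_gen.
(* Adding a copy with the letters exchanged turns every term into an orbit sum. *)
have {SR} := subalg_genD SR SR.
rewrite -{1}row_expansion_swap !row_expansionE // -big_split /=.
under eq_bigr => j _ do rewrite -big_split /=.
rewrite pair_big /=.
pose T j k := swap_sum U V A B (N - j) j (i - k) k.
rewrite (eq_bigr (fun q : 'I_N.+1 * 'I_i.+1 =>
  ((row_power_sum (N - q.1 + q.2))%:MP * T q.1 q.2) *+ ('C(i, q.2) * 'C(N, q.1)))); last first.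
  by move=> q _; rewrite -mulrnDl -mulrDr addrC.
(* The indices j = 0, k = i and j = N, k = 0 have exponents p + 1 and 0; both give the wanted orbit
   sum. *)
rewrite (bigD1 (ord0, ord_max)) //= (bigD1 (ord_max, ord0)) /=; last first.
  by rewrite xpair_eqE -val_eqE /=; lia.
rewrite !bin0 !binn !mulr1n subn0 subnn add0n Ni.
have [-> ->] := row_power_sum_ends.
have -> : T N 0%N = T 0%N i by rewrite /T swap_sumC !subnn !subn0.
set rest := (X in _ + (_ + X)) => SR.
have Srest : S rest.
  apply: subalg_gen_sum => -[j k] /= /andP[q1 q2].
  have jN := ltn_ord j; have ki := ltn_ord k.
  have d_bnd : (0 < N - j + k < p.+1)%N.
    move: q1 q2; rewrite !xpair_eqE -!val_eqE /=; lia.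
  rewrite -mulr_natl -(rmorph_nat (@mpolyC 4 L)).
  apply: subalg_genM; first exact: subalg_genC.
  (* Equal exponents of [row_elt] and [row_conj] mean weight exactly zero; otherwise the coefficient
     vanishes. *)
  case: (eqVneq (N - j + k)%N (p.+1 - (N - j + k))%N) => [e|ne].
    apply: subalg_genM; first exact: subalg_genC.
    by apply: diagonal_gens_weight0; lia.
  by rewrite row_power_sum_eq0 // rmorph0 mul0r; apply: (subalg_genC _ 0).
have := subalg_genB SR Srest; rewrite addrA addrK -mulrDl -rmorphD -rmorphD => S4.
have := subalg_gen_unit _ S4; rewrite /T subn0 subnn; apply.
(* The coefficient 2 + 2 is nonzero because 2 is. *)
by rewrite fmorph_eq0 -natrD (_ : (2 + 2 = 2 * 2)%N) // natrM mulf_neq0.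
Qed.

Lemma diagonal_gens_swap_sum i j k l : i + l = j + k %[mod p.+1] ->
  S (swap_sum U V A B i j k l).
Proof.
apply: swap_sum_closed.
- exact: subalg_gen1.
- exact: subalg_genB.
- exact: subalg_genM.
- exact: diagonal_gens_UV.
- exact: diagonal_gens_AB.
- exact: diagonal_gens_pairing.
move=> m; rewrite leq_eqVlt => /orP[/eqP ->|m_lt].
  by rewrite subnn swap_sum_r; apply: diagonal_gens_power_y.
case: (posnP m) => [->|m_gt0]; last by apply: diagonal_gens_Tr; rewrite m_gt0.
by rewrite subn0 swap_sum_l; apply: diagonal_gens_power_x.
Qed.

Lemma diagonal_gens_invariant f : O2_invariant lambda f -> S (diagonalize f).
Proof.
move=> f_inv; apply: (subalg_gen_unit two_neq0L).
have sw : diagonalize f = diagonalize f \mPo [tuple V; U; B; A].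
  by rewrite -diagonalize_reflection f_inv //; apply: O2minus_reflection.
have [sU sV sA sB] := comp_mpoly4 V U B A.
(* Adding the reflected copy pairs each monomial with its exchange under a common coefficient. *)
rewrite rmorph_nat mulr_natl mulr2n {2}sw {1 2}(mpolyE (diagonalize f)) rmorph_sum -big_split /=.
rewrite big_seq; apply: subalg_gen_sum => m m_supp.
rewrite comp_mpolyZ -scalerDr -mul_mpolyC; apply: subalg_genM; first exact: subalg_genC.
rewrite (mpolyX4 m) !rmorphM !rmorphXn /= sU sV sA sB.
by apply: diagonal_gens_swap_sum; apply: (invariant_weight f_inv).
Qed.

(** * Return to the original variables and descent to F_p *)

Lemma undiagonalize f : diagonalize f \mPo
  [tuple U + W * V; U - W * V; A + Wi * B; A - Wi * B] = map_mpoly iota f.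
Proof.
have [dx1 dx2 dy1 dy2] := diagonalizeX.
(* After this substitution [U], [V], [A], [B] play the roles of x1, x2, y1, y2. *)
set t := [tuple _; _; _; _].
have [sU sV sA sB] := comp_mpoly4 (U + W * V) (U - W * V) (A + Wi * B) (A - Wi * B).
have half z : z = (h + h) * z by rewrite mpolyC_half mul1r.
apply: (eq_rmorph_mpoly (f := comp_mpoly t \o diagonalize) (g := map_mpoly iota)).
  by move=> x /=; rewrite diagonalizeC comp_mpolyC map_mpolyC.
apply: forall_ord4 => /=; rewrite map_mpolyX.
- by rewrite dx1 rmorphM rmorphD /= comp_mpolyC sU sV [RHS]half; ring.
- rewrite dx2 !rmorphM rmorphB /= !comp_mpolyC sU sV [RHS]half -[V in RHS]mul1r -mpolyC_divff.
  by ring.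
- by rewrite dy1 rmorphM rmorphD /= comp_mpolyC sA sB [RHS]half; ring.
- rewrite dy2 !rmorphM rmorphB /= !comp_mpolyC sA sB [RHS]half -[B in RHS]mul1r -mpolyC_divff.
  by ring.
Qed.

(** Undoing the diagonalization leaves a combination over [L] of products of the original
    generators, whose coefficients lie in F_p. *)
Lemma map_in_subalg n (gs : n.-tuple {mpoly 'F_p[4]}) f (Q : {mpoly L[n]}) :
  diagonalize f = Q \mPo [tuple diagonalize (tnth gs k) | k < n] ->
  map_mpoly iota f = \sum_(m <- msupp Q)
    Q@_m *: map_mpoly iota (\prod_(k < n) tnth gs k ^+ m k).
Proof.
move=> e; rewrite -undiagonalize e.
set t := [tuple _; _; _; _]; set ds := [tuple diagonalize _ | _ < n].
have -> : (Q \mPo ds) \mPo t = Q \mPo [tuple map_mpoly iota (tnth gs k) | k < n].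
  apply: (eq_rmorph_mpoly (f := comp_mpoly t \o comp_mpoly ds)) => [x|k] /=.
    by rewrite !comp_mpolyC.
  by rewrite !comp_mpolyXU -!tnth_nth !tnth_mktuple undiagonalize.
rewrite comp_mpolyE; apply: eq_bigr => m _; rewrite rmorph_prod; congr (_ *: _).
by apply: eq_bigr => k _; rewrite tnth_mktuple rmorphXn.
Qed.

(** Applying [rho] to each coefficient of that identity keeps the products and moves the scalars
    into F_p. *)
Lemma diagonal_descent (rho : {additive L -> 'F_p}) n (gs : n.-tuple {mpoly 'F_p[4]}) f :
  (forall x c, rho (x * iota c) = rho x * c) -> rho 1 = 1 ->
  subalg_gen [tuple diagonalize (tnth gs k) | k < n] (diagonalize f) -> in_subalg gs f.
Proof.
move=> rhoM rho1 [Q /map_in_subalg e].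
exists (\sum_(m <- msupp Q) rho Q@_m *: 'X_[m]); apply/mpolyP => m.
have := congr1 (fun q => rho (mcoeff m q)) e.
have rhoK c : rho (iota c) = c by rewrite -[iota c]mul1r rhoM rho1 mul1r.
rewrite /= mcoeff_map_mpoly rhoK => ->.
rewrite (raddf_sum (comp_mpoly gs)) !(raddf_sum (mcoeff m)) (raddf_sum rho) /=.
apply: eq_bigr => q _.
by rewrite mcoeffZ mcoeff_map_mpoly rhoM comp_mpolyZ mcoeffZ comp_mpolyX.
Qed.

End Diagonalization.

(** * Euler's criterion for lambda and its square root *)

Section Lambda.
Variables (p : nat) (lambda : 'F_p).
Hypothesis pr_p : prime p.
Hypothesis odd_p : odd p.

Lemma Fp_two_neq0 : 2%:R != 0 :> 'F_p.
Proof.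
have p_gt2 := odd_prime_gt2 odd_p pr_p.
by rewrite -(dvdn_pcharf (pchar_Fp pr_p)) gtnNdvd.
Qed.

Lemma Fp_one_neqN1 : 1 != - 1 :> 'F_p.
Proof. by rewrite -subr_eq0 opprK; exact: Fp_two_neq0. Qed.

Lemma expFp_pred (t : 'F_p) : t != 0 -> t ^+ p.-1 = 1.
Proof.
move=> t0; apply: (mulfI t0); rewrite -exprS prednK ?prime_gt0 // mulr1.
exact: expFp.
Qed.

(** If p is 3 modulo 4, the exponent (p - 1)/2 is odd. Otherwise the power squares to 1, and the
    value 1 would make all p - 1 units, being powers of lambda, roots of X^((p-1)/2) - 1. *)
Lemma lambda_Euler :
  ((p %% 4 = 3)%N -> lambda = -1) ->
  ((p %% 4 = 1)%N -> forall u : 'F_p, u != 0 -> exists k : nat, u = lambda ^+ k) ->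
  lambda ^+ p./2 = -1.
Proof.
move=> H3 H1.
have ep : p = (p./2).*2.+1 by rewrite -{1}(odd_double_half p) odd_p.
have [m3|m1] : (p %% 4 = 3)%N \/ (p %% 4 = 1)%N by lia.
  rewrite (H3 m3) -signr_odd.
  by have -> : odd p./2 by lia.
have p_gt2 := odd_prime_gt2 odd_p pr_p.
have half_gt0 : (0 < p./2)%N by lia.
(* The unit -1 must be a power of lambda, while 0 has only the powers 1 and 0. *)
have lam0 : lambda != 0.
  apply/eqP => lam0; have N1 : - 1 != 0 :> 'F_p by rewrite oppr_eq0 oner_eq0.
  have [[|k]] := H1 m1 _ N1; rewrite lam0.
    by rewrite expr0 => /esym /eqP; rewrite (negPf Fp_one_neqN1).
  by rewrite exprS mul0r => /eqP; rewrite (negPf N1).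
have : (lambda ^+ p./2) ^+ 2 == 1.
  rewrite -exprM muln2 -(expFp_pred lam0).
  by have -> : p.-1 = (p./2).*2 by lia.
rewrite sqrf_eq1 => /orP[/eqP e1|/eqP //]; exfalso.
have all1 : all (p./2).-unity_root (enum (predC1 (0 : 'F_p))).
  apply/allP => u; rewrite mem_enum => /(H1 m1)[k ->].
  by rewrite unity_rootE -exprM mulnC exprM e1 expr1n.
have := max_unity_roots half_gt0 all1 (enum_uniq _).
rewrite -cardE cardC1 card_Fp //; lia.
Qed.

Hypothesis lam_Euler : lambda ^+ p./2 = -1.

Lemma Euler_neq0 : lambda != 0.
Proof.
have p_gt2 := odd_prime_gt2 odd_p pr_p.
apply/eqP => lam0; move/eqP: lam_Euler; rewrite lam0 expr0n.
have -> : (p./2 == 0)%N = false by lia.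
by rewrite eq_sym oppr_eq0 oner_eq0.
Qed.

Lemma Euler_nonsquare t : t ^+ 2 != lambda.
Proof.
apply/eqP => et; have t0 : t != 0.
  by apply: contraNneq Euler_neq0 => t0; rewrite -et t0 expr0n.
have := lam_Euler; rewrite -et -exprM mul2n.
have -> : (p./2).*2 = p.-1 by lia.
by rewrite expFp_pred // => /eqP; rewrite (negPf Fp_one_neqN1).
Qed.

(** For a root w of X^2 - lambda in a splitting field, w^p = w (w^2)^((p-1)/2) = w lambda^((p-1)/2)
    = -w. *)
Lemma Euler_sqrt : exists (L : fieldExtType 'F_p) (w : L),
  w ^+ 2 = GRing.in_alg L lambda /\ w ^+ p = - w.
Proof.
have mon : 'X^2 - lambda%:P \is monic by rewrite monicXnsubC.
have [L [rs eL _]] := FinSplittingFieldFor (monic_neq0 mon).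
have [w rw] : exists w, root (map_poly (GRing.in_alg L) ('X^2 - lambda%:P)) w.
  case: rs eL => [|w rs] eL; last first.
    by exists w; rewrite (eqp_root eL) root_prod_XsubC mem_head.
  by move: (eqp_size eL); rewrite big_nil size_map_poly size_XnsubC // size_poly1.
exists L, w.
have w2 : w ^+ 2 = GRing.in_alg L lambda.
  move: rw; rewrite rmorphB /= map_polyXn map_polyC rootE !hornerE subr_eq0.
  by move/eqP.
split=> //; have -> : w ^+ p = w * (w ^+ 2) ^+ p./2.
  by rewrite -exprM -exprS mul2n; congr (_ ^+ _); lia.
by rewrite w2 -rmorphXn lam_Euler rmorphN rmorph1 mulrN1.
Qed.

End Lambda.

Theorem theorem1p3 (p : nat) (lambda : 'F_p) :
  prime p -> odd p ->
  ((p %% 4 = 3)%N -> lambda = -1) ->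
  ((p %% 4 = 1)%N -> forall u : 'F_p, u != 0 -> exists k : nat, u = lambda ^+ k) ->
  forall f : {mpoly 'F_p[4]},
    O2_invariant lambda f <-> in_subalg (gens lambda) f.
Proof.
move=> pr_p odd_p H3 H1 f.
have lamE := lambda_Euler pr_p odd_p H3 H1.
have two0 := Fp_two_neq0 pr_p odd_p.
have lam0 := Euler_neq0 pr_p odd_p lamE.
have nsq := Euler_nonsquare pr_p odd_p lamE.
split=> [f_inv | [P ->] g Og]; last first.
  by apply: act_comp => k; rewrite tnth_mktuple; apply: act_gen.
have [L [w [w2 wp]]] := Euler_sqrt pr_p odd_p lamE.
have free1 : free [tuple (1 : L)] by rewrite seq1_free oner_eq0.
(* The retraction is the coordinate form of the free family consisting of 1: it is F_p-linear on [L]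
   and sends 1 to 1. *)
apply: (diagonal_descent two0 lam0 w2 (rho := coord [tuple (1 : L)] 0)).
- by move=> x c; rewrite /= -scalerAr mulr1 linearZ /= mulrC.
- by have := coord_free 0 0 free1; rewrite /= => ->.
- exact: diagonal_gens_invariant pr_p two0 lam0 nsq w2 wp _ f_inv.
Qed.
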